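(* For every $n\geq 1$, \[f_n\geq 3p_n-6.\] In particular, for the null sequence $r(n):=6/p_n$ one has \[\frac{f_n}{p_n}\geq 3-r(n)\quad\text{for every }n\geq 1.\]
   Context: Let $p_1=2,p_2=3,p_3=5,\ldots$ be the prime numbers in increasing order. For $n\ge1$ let $S_n\subseteq\mathbb{N}$ be the numerical semigroup generated by all primes not less than $p_n$ (i.e. the set of all finite sums, including the empty sum $0$, of primes $\ge p_n$); its complement in $\mathbb{N}$ is finite. The Frobenius number $f_n$ of $S_n$ is the largest integer not contained in $S_n$. *)

(* Defs.v *)
From HB Require Import structures.
From mathcomp Require Import all_boot all_order all_algebra.
From mathcomp Require Import zify.
From mathcomp Require Import all_classical all_reals all_analysis.
Import numFieldNormedType.Exports.

Set Implicit Arguments.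
Unset Strict Implicit.
Unset Printing Implicit Defensive.

Import Order.TTheory GRing.Theory Num.Theory.
Local Open Scope classical_set_scope.
Local Open Scope ring_scope.

Lemma next_prime_subproof (m : nat) : exists q, (m < q)%N && prime q.
Proof. by have [q mq pq] := prime_above m; exists q; rewrite mq pq. Qed.

Definition next_prime (m : nat) : nat := ex_minn (next_prime_subproof m).

(* [nth_prime 1 = 2], [nth_prime 2 = 3], [nth_prime 3 = 5], ...; the value
   [nth_prime 0 = 0] is a dummy that starts the recursion. *)
Fixpoint nth_prime (n : nat) : nat :=
  if n is m.+1 then next_prime (nth_prime m) else 0%N.

(* The submonoid of (nat, +) generated by [A]. *)
Definition semigroup_gen (A : set nat) : set nat :=
  [set m | exists2 s : seq nat, (forall q, q \in s -> A q) & m = sumn s].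

Definition prime_semigroup (n : nat) : set nat :=
  semigroup_gen [set q | prime q /\ (nth_prime n <= q)%N].

(* [z] is the largest integer not in [S]. It is integer-valued because the
   Frobenius number of [setT] is -1. *)
Definition is_frobenius (S : set nat) (z : int) : Prop :=
  let gap (x : int) := ~ exists2 m : nat, S m & x = m%:Z in
  gap z /\ forall x : int, gap x -> x <= z.

(* The default value 0 is taken only when [S] is not cofinite. *)
Definition frobenius (S : set nat) : int := xget 0 (is_frobenius S).

Definition prime_frobenius (n : nat) : int := frobenius (prime_semigroup n).

Lemma nth_primeS (n : nat) :
  [/\ prime (nth_prime n.+1), (nth_prime n < nth_prime n.+1)%N &
      forall q, prime q -> (nth_prime n < q)%N -> (nth_prime n.+1 <= q)%N].
Proof.
rewrite /= /next_prime; case: ex_minnP => m /andP[lm pm] minm.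
by split=> // q pq lq; apply: minm; rewrite lq pq.
Qed.

Lemma is_frobenius_unique (S : set nat) (y z : int) :
  is_frobenius S y -> is_frobenius S z -> y = z.
Proof.
by move=> [gy my] [gz mz]; apply/eqP; rewrite eq_le mz // my.
Qed.

Lemma sumn_nseq2 a b (q r : nat) :
  sumn (nseq a q ++ nseq b r) = (a * q + b * r)%N.
Proof. by rewrite sumn_cat !sumn_nseq !(mulnC q, mulnC r). Qed.

Lemma prime_semigroup_cofinite (n : nat) :
  exists N, forall m, (N <= m)%N -> prime_semigroup n m.
Proof.
have [q lq pq] := prime_above (nth_prime n).
have [r lr pr] := prime_above q.
have cqr : coprime r q.
  by rewrite prime_coprime // dvdn_prime2 // gtn_eqF.
exists (q * r)%N => m lm.
pose a := (chinese r q m 0 %% (r * q))%N.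
have ar : (a = m %[mod r])%N.
  by rewrite /a modn_dvdm ?dvdn_mulr // chinese_modl.
have aq : (q %| a)%N.
  by rewrite /dvdn /a modn_dvdm ?dvdn_mull // chinese_modr // mod0n.
have am : (a <= m)%N.
  apply: leq_trans lm; rewrite mulnC ltnW // ltn_mod muln_gt0.
  by rewrite !prime_gt0.
have rma : (r %| m - a)%N by rewrite -eqn_mod_dvd // ar.
exists (nseq (a %/ q) q ++ nseq ((m - a) %/ r) r).
  move=> x; rewrite mem_cat !mem_nseq => /orP[] /andP[_ /eqP ->] /=.
    by split=> //; exact: ltnW.
  by split=> //; apply: ltnW; exact: ltn_trans lr.
by rewrite sumn_nseq2 !divnK // subnKC.
Qed.

Lemma prime_semigroup1 (n : nat) : ~ prime_semigroup n 1%N.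
Proof.
move=> [[|q s] hs] //= e.
have [/prime_gt1] := hs q (mem_head q s).
by move: e; lia.
Qed.

Lemma prime_frobeniusP (n : nat) :
  is_frobenius (prime_semigroup n) (prime_frobenius n).
Proof.
apply: xgetPex; have [N hN] := prime_semigroup_cofinite n.
pose P m := `[< ~ prime_semigroup n m >].
have exP : exists m, P m by exists 1%N; apply/asboolP; exact: prime_semigroup1.
have ubP m : P m -> (m <= N)%N.
  by move=> /asboolP nm; rewrite leqNgt; apply/negP => /ltnW /hN.
case: (ex_maxnP exP ubP) => f /asboolP nf maxf.
exists f%:Z; split=> [[m Sm] [fm]|[m|m] gm].
- by apply: nf; rewrite fm.
- rewrite lez_nat; apply: maxf; apply/asboolP => Sm.
  by apply: gm; exists m.
- by rewrite NegzE; lia.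
Qed.

(* Main.v *)
Require Import Defs.
From mathcomp Require Import all_boot all_order all_algebra.
From mathcomp Require Import zify.
From mathcomp Require Import all_classical all_reals all_analysis.
Import numFieldNormedType.Exports.
Import Order.TTheory GRing.Theory Num.Theory.
Local Open Scope classical_set_scope.
Local Open Scope ring_scope.

(* For p = p_n >= 5 every prime >= p is odd, so a representation of the odd
   number 3p - 6 as a sum of such primes has an odd number of terms. Three
   terms already sum to at least 3p, and 3p - 6 = 3(p - 2) is itself not prime;
   hence 3p - 6 is a gap of S_n. For p = 2 and p = 3 this fails, and the gaps 1
   and 4 are used instead. *)

Lemma gap_le_prime_frobenius (n m : nat) :
  ~ prime_semigroup n m -> m%:Z <= prime_frobenius n.
Proof.
move=> nSm; apply: (prime_frobeniusP n).2 => -[k Sk [mk]].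
by apply: nSm; rewrite mk.
Qed.

(** Each generator is at least [nth_prime n], so below three times that value a sum has at most two
    terms. *)
Lemma prime_semigroup_lt3 (n m : nat) :
  prime_semigroup n m -> (m < 3 * nth_prime n)%N ->
  [\/ m = 0%N, prime m |
      exists q r, [/\ prime q, prime r, (nth_prime n <= q)%N,
                      (nth_prime n <= r)%N & m = (q + r)%N]].
Proof.
move=> [[|q [|r [|t s]]] hs ->] /= lt3.
- exact: Or31.
- by apply: Or32; rewrite addn0; case: (hs q (mem_head _ _)).
- apply: Or33; exists q, r; rewrite addn0.
  have [pq lq] := hs q (mem_head _ _).
  by have [|pr lr] := hs r; rewrite ?inE ?eqxx ?orbT.
- have [_ lq] := hs q (mem_head _ _).
  have [|_ lr] := hs r; first by rewrite !inE eqxx orbT.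
  have [|_ lt] := hs t; first by rewrite !inE eqxx !orbT.
  lia.
Qed.

Lemma prime_nth_prime (n : nat) : (1 <= n)%N -> prime (nth_prime n).
Proof. by case: n => // n _; case: (nth_primeS n). Qed.

(** Crude growth bound, enough to make the error term [6 / nth_prime n] vanish in the limit. *)
Lemma ltn_nth_prime (n : nat) : (1 <= n)%N -> (n < nth_prime n)%N.
Proof.
elim: n => // -[_ _|n IHn _]; first exact/prime_gt1/prime_nth_prime.
by have [_ lt _] := nth_primeS n.+1; apply: leq_ltn_trans lt; exact: IHn.
Qed.

Lemma prime_semigroup_gap (n : nat) : (5 <= nth_prime n)%N ->
  ~ prime_semigroup n (3 * nth_prime n - 6)%N.
Proof.
case: n => // n; set p := nth_prime n.+1 => p5 Sm.
have odd_ge q : prime q -> (p <= q)%N -> odd q.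
  by move=> /even_prime[] // ->; lia.
have oddp : odd p by apply: odd_ge => //; exact: prime_nth_prime.
have [||pm|[q [r [pq pr lq lr e]]]] := prime_semigroup_lt3 _ _ Sm.
- by rewrite -/p; lia.
- by lia.
(* A prime divisible by 3 equals 3, which would force [p = 3]. *)
- have : (3 %| 3 * p - 6)%N by lia.
  by rewrite dvdn_prime2 // => /eqP; lia.
- by have := odd_ge q pq lq; have := odd_ge r pr lr; lia.
Qed.

Lemma prime_frobenius_ge (n : nat) : (1 <= n)%N ->
  3 * (nth_prime n)%:Z - 6 <= prime_frobenius n.
Proof.
move=> n1; have pp := prime_nth_prime n n1.
have [p5|] := leqP 5 (nth_prime n).
  by have := gap_le_prime_frobenius _ _ (prime_semigroup_gap n p5); lia.
have [p3|p3 p5] := eqVneq (nth_prime n) 3%N.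
  (* 4 is not prime, and two primes at least 3 sum to at least 6. *)
  have nS4 : ~ prime_semigroup n 4%N.
    move=> /prime_semigroup_lt3; rewrite p3 => /(_ isT).
    by move=> [||[q [r [_ _]]]] //; lia.
  by have := gap_le_prime_frobenius _ _ nS4; lia.
(* What remains is [nth_prime n <= 2], where the bound is at most 0 and the gap 1 suffices. *)
have p4 : nth_prime n != 4%N by apply/eqP => p4; rewrite p4 in pp.
by have := gap_le_prime_frobenius _ _ (@prime_semigroup1 n); lia.
Qed.

Lemma cvg_div_nth_prime (R : realType) (c : R) :
  c / (nth_prime n)%:R @[n --> \oo] --> (0 : R).
Proof.
rewrite -[0 in X in _ --> X](mulr0 c); apply: cvgMr.
(* [harmonic] at [n] is [1 / (n + 1)], so the strict bound [n < nth_prime n] is exactly what the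
   comparison needs. *)
apply: (@squeeze_cvgr _ _ _ _ (fun=> 0) (@harmonic R)).
- near=> n; rewrite invr_ge0 ler0n /=.
  have n1 : (1 <= n)%N by near: n; exact: nbhs_infty_ge.
  rewrite lef_pV2 ?posrE ?ltr0n ?ler_nat ?ltn_nth_prime //.
  by rewrite prime_gt0 // prime_nth_prime.
- exact: cvg_cst.
- exact: cvg_harmonic.
Unshelve. all: by end_near. Qed.

Theorem proposition1 (R : realType) :
  (forall n : nat, (1 <= n)%N ->
     3 * (nth_prime n)%:Z - 6 <= prime_frobenius n) /\
  let r := fun n : nat => 6 / (nth_prime n)%:R : R in
  (r n @[n --> \oo] --> (0 : R)) /\
  (forall n : nat, (1 <= n)%N ->
     3 - r n <= (prime_frobenius n)%:~R / (nth_prime n)%:R).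
Proof.
split; first exact: prime_frobenius_ge.
move=> r; split; first exact: cvg_div_nth_prime.
move=> n n1; have p0 : 0 < (nth_prime n)%:R :> R.
  by rewrite ltr0n prime_gt0 // prime_nth_prime.
(* Clearing the positive denominator leaves the integer bound, cast to [R]. *)
rewrite /r ler_pdivlMr // mulrBl divfK ?gt_eqF //.
have := prime_frobenius_ge n n1.
by rewrite -(ler_int R) rmorphB rmorphM.
Qed.
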